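(* Let $H$, $J$, $A$ and the Dirac operator $D=D_0+D_1+D_R$ be as in the context, and suppose $\alpha_{13}=\alpha_{14}=0$ and $\delta_{ij}=0$ for all $i\in\{1,2\}$, $j\in\{2,3,4\}$. Then the Hodge property $\mathcal{C}\ell_D(A)'=\mathcal{C}\ell_D(A)^\circ$ holds if and only if $\delta_{21}\neq 0$, $(\alpha_{23},\alpha_{24})\neq(0,0)$, and the matrix $\beta=\begin{bmatrix}\beta_{13}&\beta_{14}\\ \beta_{23}&\beta_{24}\end{bmatrix}$ has no zero row.
   Context: Let $H=M_4(\mathbb{C})\oplus M_4(\mathbb{C})$, with elements written as pairs $(v,w)$ and inner product $\langle (v,w),(v',w')\rangle=\mathrm{Tr}(v^*v')+\mathrm{Tr}(w^*w')$. Let $J$ be the antilinear isometry $J(v,w)=(w^*,v^* )$. Identify $\mathrm{End}_{\mathbb{C}}(H)$ with $M_4(\mathbb{C})\otimes M_2(\mathbb{C})\otimes M_4(\mathbb{C})$ via $\big(x\otimes\begin{bmatrix}a&b\\c&d\end{bmatrix}\otimes y\big)(v,w)=\big(x(av+bw)y^t,\ x(cv+dw)y^t\big)$. Here $e_{ij}$ denotes the matrix unit with $1$ in position $(i,j)$ (size clear from context) and $1$ the identity matrix. Let $A\cong\mathbb{C}\oplus\mathbb{H}\oplus M_3(\mathbb{C})$ be the real $*$-algebra of operators $\mathrm{diag}(\lambda,\bar\lambda,q)\otimes e_{11}\otimes 1+\mathrm{diag}(\lambda,m)\otimes e_{22}\otimes 1$, where $\lambda\in\mathbb{C}$, $q$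 is a quaternion viewed as a $2\times 2$ complex matrix $\begin{bmatrix}z&w\\-\bar w&\bar z\end{bmatrix}$, $m\in M_3(\mathbb{C})$, and $\mathrm{diag}$ denotes block-diagonal $4\times4$ matrices. Fix complex parameters $\alpha_{ij},\beta_{ij}$ ($i\in\{1,2\}$, $j\in\{3,4\}$), $\delta_{12},\delta_{13},\delta_{14},\delta_{21},\delta_{22},\delta_{23},\delta_{24}$ and $\Upsilon_R$. Put $\alpha=\begin{bmatrix}\alpha_{13}&\alpha_{14}\\ \alpha_{23}&\alpha_{24}\end{bmatrix}$, $\beta=\begin{bmatrix}\beta_{13}&\beta_{14}\\ \beta_{23}&\beta_{24}\end{bmatrix}$, $X_\alpha=\begin{bmatrix}0&\alpha\\ \alpha^*&0\end{bmatrix}\in M_4(\mathbb{C})$ (in $2\times2$ blocks), $X_\beta$ likewise, and $Y\in M_4(\mathbb{C})$ the matrix with first row $(0,\delta_{12},\delta_{13},\delta_{14})$, second row $(\delta_{21},\delta_{22},\delta_{23},\delta_{24})$ and zero third and fourth rows. Define $D_0=X_\alpha\otimes e_{11}\otimes e_{11}+X_\beta\otimes e_{11}\otimes(1-e_{11})+Y\otimes e_{12}\otimes e_{11}+Y^*\otimes e_{21}\otimes e_{11}$, $D_1=JD_0J^{-1}$, $D_R=e_{11}\otimes(\Upsilon_R e_{21}+\overline{\Upsilon}_R e_{12})\otimes e_{11}$, and $D=D_0+D_1+D_R$. For $\xi\in\mathrm{End}_{\mathbb{C}}(H)$ set $\xi^\circ=J\xi^*J^{-1}$, and for a subset $S$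 set $S^\circ=\{\xi^\circ:\xi\in S\}$ and $S'=\{\xi\in\mathrm{End}_{\mathbb{C}}(H): [\xi,\eta]=0\ \forall\eta\in S\}$. $\mathcal{C}\ell_D(A)$ is the complex $*$-subalgebra of $\mathrm{End}_{\mathbb{C}}(H)$ generated by $A$ and the operators $a[D,b]$, $a,b\in A$. The Hodge property means $\mathcal{C}\ell_D(A)'=\mathcal{C}\ell_D(A)^\circ$. *)

(* Defs.v *)
(* Complex numbers are modelled as R[i] (real_closed's
   [complex R]) for an arbitrary [R : realType]; for R = the reals this is C. *)
From HB Require Import structures.
From mathcomp Require Import all_boot all_order all_algebra.
From mathcomp Require Import complex.
From mathcomp Require Import reals.
Set Implicit Arguments. Unset Strict Implicit. Unset Printing Implicit Defensive.
Import Order.TTheory GRing.Theory Num.Theory.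
Local Open Scope ring_scope.

Section Defs.
Variable R : realType.
Notation C := (R[i]).

(* conjugate transpose (= Hilbert-space adjoint in an orthonormal basis) *)
Definition adj {m n} (M : 'M[C]_(m, n)) : 'M[C]_(n, m) :=
  (map_mx (fun z : C => z^*) M)^T.

(* 1-based matrix units e_ij of size 2 and 4 *)
Definition e2 (i j : nat) : 'M[C]_2 := delta_mx (inord i.-1) (inord j.-1).
Definition e4 (i j : nat) : 'M[C]_4 := delta_mx (inord i.-1) (inord j.-1).

(* H = M_4(C) (+) M_4(C), elements (v, w) *)
Definition H := ('M[C]_4 * 'M[C]_4)%type.

(* orthonormal coordinates on H (w.r.t. <(v,w),(v',w')> = Tr v^*v' + Tr w^*w'):
   index 16*k + 4*p + q  <->  entry (p,q) of component k (k=0: v, k=1: w). *)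
Definition compo (i : 'I_32) : nat := (i %/ 16)%N.
Definition rowi (i : 'I_32) : nat := ((i %% 16) %/ 4)%N.
Definition coli (i : 'I_32) : nat := (i %% 4)%N.
Definition idx (k p q : nat) : 'I_32 := inord (16 * k + 4 * p + q).

Definition toH (u : 'cV[C]_32) : H :=
  (\matrix_(p < 4, q < 4) u (idx 0 p q) ord0,
   \matrix_(p < 4, q < 4) u (idx 1 p q) ord0).
Definition ofH (h : H) : 'cV[C]_32 :=
  \col_i (if compo i == 0%N then h.1 else h.2) (inord (rowi i)) (inord (coli i)).

(* the matrix (in the orthonormal basis above) of a C-linear map f : H -> H *)
Definition matOf (f : H -> H) : 'M[C]_32 :=
  \matrix_(i, j) (ofH (f (toH (delta_mx j ord0)))) i ord0.

(* End_C(H) = 'M[C]_32 ; identification with M_4 (x) M_2 (x) M_4 *)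
Definition actT (x : 'M[C]_4) (m : 'M[C]_2) (y : 'M[C]_4) (h : H) : H :=
  let: (v, w) := h in
  (x *m (m (inord 0) (inord 0) *: v + m (inord 0) (inord 1) *: w) *m y^T,
   x *m (m (inord 1) (inord 0) *: v + m (inord 1) (inord 1) *: w) *m y^T).
Definition tens (x : 'M[C]_4) (m : 'M[C]_2) (y : 'M[C]_4) : 'M[C]_32 :=
  matOf (actT x m y).

(* the antilinear isometry J(v,w) = (adj w, adj v); J^{-1} = J *)
Definition JH (h : H) : H := (adj h.2, adj h.1).
(* J xi J^{-1} (a C-linear operator) *)
Definition Jconj (M : 'M[C]_32) : 'M[C]_32 :=
  matOf (fun h => JH (toH (M *m ofH (JH h)))).
(* xi^o = J (adj xi) J^{-1} *)
Definition opp (M : 'M[C]_32) : 'M[C]_32 := Jconj (adj M).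

(* the real *-algebra A = C (+) H (+) M_3(C) *)
Definition quat (z w : C) : 'M[C]_2 :=
  \matrix_(i < 2, j < 2)
    (if (i == 0 :> nat) then (if (j == 0 :> nat) then z else w)
     else (if (j == 0 :> nat) then - w^* else z^*)).
Definition diag_lam_lamc_q (lam z w : C) : 'M[C]_4 :=
  block_mx (\matrix_(i < 2, j < 2)
              (if i == j then (if (i == 0 :> nat) then lam else lam^*) else 0))
           0 0 (quat z w).
Definition diag_lam_m (lam : C) (m : 'M[C]_3) : 'M[C]_4 :=
  block_mx (lam%:M : 'M[C]_1) 0 0 m.
Definition inA (a : 'M[C]_32) : Prop :=
  exists (lam z w : C) (m : 'M[C]_3),
    a = tens (diag_lam_lamc_q lam z w) (e2 1 1) 1%:M
        + tens (diag_lam_m lam m) (e2 2 2) 1%:M.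

(* the Dirac operator *)
Definition Xmat (al : 'M[C]_2) : 'M[C]_4 := block_mx 0 al (adj al) 0.
Definition mat2 (a b c d : C) : 'M[C]_2 :=
  \matrix_(i < 2, j < 2)
    (if (i == 0 :> nat) then (if (j == 0 :> nat) then a else b)
     else (if (j == 0 :> nat) then c else d)).
Definition Ymat (d12 d13 d14 d21 d22 d23 d24 : C) : 'M[C]_4 :=
  \matrix_(i < 4, j < 4)
    (if (i == 0 :> nat) then [:: 0; d12; d13; d14]`_j
     else if (i == 1 :> nat) then [:: d21; d22; d23; d24]`_j
     else 0).

Definition D0 (al be Y : 'M[C]_4) : 'M[C]_32 :=
  tens al (e2 1 1) (e4 1 1) + tens be (e2 1 1) (1%:M - e4 1 1)
  + tens Y (e2 1 2) (e4 1 1) + tens (adj Y) (e2 2 1) (e4 1 1).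
Definition DR (ups : C) : 'M[C]_32 :=
  tens (e4 1 1) (ups *: e2 2 1 + ups^* *: e2 1 2) (e4 1 1).

Definition Dirac (a13 a14 a23 a24 b13 b14 b23 b24
                  d12 d13 d14 d21 d22 d23 d24 ups : C) : 'M[C]_32 :=
  let d0 := D0 (Xmat (mat2 a13 a14 a23 a24)) (Xmat (mat2 b13 b14 b23 b24))
               (Ymat d12 d13 d14 d21 d22 d23 d24) in
  d0 + Jconj d0 + DR ups.

(* complex *-subalgebra of End_C(H) generated by a set S *)
Inductive gen_star_alg (S : 'M[C]_32 -> Prop) : 'M[C]_32 -> Prop :=
| gsa_base x : S x -> gen_star_alg S x
| gsa_add x y : gen_star_alg S x -> gen_star_alg S y -> gen_star_alg S (x + y)
| gsa_scale (c : C) x : gen_star_alg S x -> gen_star_alg S (c *: x)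
| gsa_mul x y : gen_star_alg S x -> gen_star_alg S y -> gen_star_alg S (x *m y)
| gsa_adj x : gen_star_alg S x -> gen_star_alg S (adj x).

(* Cl_D(A): generated by A and the a[D,b], a b in A *)
Definition ClD (D : 'M[C]_32) : 'M[C]_32 -> Prop :=
  gen_star_alg (fun x => inA x \/
    exists a b, inA a /\ inA b /\ x = a *m (D *m b - b *m D)).

Definition commutant (S : 'M[C]_32 -> Prop) (xi : 'M[C]_32) : Prop :=
  forall eta, S eta -> xi *m eta = eta *m xi.
Definition opp_set (S : 'M[C]_32 -> Prop) (xi : 'M[C]_32) : Prop :=
  exists eta, S eta /\ xi = opp eta.

(* Hodge property: Cl_D(A)' = Cl_D(A)^o *)
Definition Hodge (D : 'M[C]_32) : Prop :=
  forall xi, commutant (ClD D) xi <-> opp_set (ClD D) xi.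

End Defs.

(* Main.v *)
Require Import Defs.
From HB Require Import structures.
From mathcomp Require Import all_boot all_order all_algebra.
From mathcomp Require Import complex.
From mathcomp Require Import reals.
From mathcomp Require Import zify ring.
Import Order.TTheory GRing.Theory Num.Theory.
Local Open Scope ring_scope.
Set Implicit Arguments. Unset Strict Implicit. Unset Printing Implicit Defensive.

(* Up to relabelling the basis, the algebra
   B = C + M_4(C) + M_4(C) + M_3(C) acts on H with multiplicities 4, 1, 3, 4,
   and xi |-> xi^o exchanges the first two and the last two summands, acting by
   left multiplication, with their multiplicity spaces; hence B' = B^o.
   The operator D_0 lies in B, so D_1 lies in B', while D_R commutes with A;
   thus [D, b] = [D_0, b] for b in A, and Cl_D(A) is contained in B.
   If the four nonvanishing conditions hold, the corners e [D, f] with e, f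
   matrix units of the complexification of A generate all matrix units of B,
   so Cl_D(A) = B. If one of them fails, some diagonal projection commutes with
   Cl_D(A) but not with B; were the Hodge property true, this projection would
   lie in Cl_D(A)^o, which is contained in B^o = B'. *)

(** * Coordinates on H: component, row and column of a basis vector *)

Definition comp_of (i : 'I_32) : 'I_2 := inord (compo i).
Definition row_of (i : 'I_32) : 'I_4 := inord (rowi i).
Definition col_of (i : 'I_32) : 'I_4 := inord (coli i).

Lemma idx_val (k : 'I_2) (p q : 'I_4) : idx k p q = (16 * k + 4 * p + q)%N :> nat.
Proof. by rewrite /idx inordK //; have := ltn_ord k; have := ltn_ord p; have := ltn_ord q; lia. Qed.

Lemma comp_idx (k : 'I_2) (p q : 'I_4) : comp_of (idx k p q) = k.
Proof.
apply: val_inj; rewrite /comp_of /compo idx_val /= inordK;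
  by have := ltn_ord k; have := ltn_ord p; have := ltn_ord q; lia.
Qed.

Lemma row_idx (k : 'I_2) (p q : 'I_4) : row_of (idx k p q) = p.
Proof.
apply: val_inj; rewrite /row_of /rowi idx_val /= inordK;
  by have := ltn_ord k; have := ltn_ord p; have := ltn_ord q; lia.
Qed.

Lemma col_idx (k : 'I_2) (p q : 'I_4) : col_of (idx k p q) = q.
Proof.
apply: val_inj; rewrite /col_of /coli idx_val /= inordK;
  by have := ltn_ord k; have := ltn_ord p; have := ltn_ord q; lia.
Qed.

Lemma idxK i : idx (comp_of i) (row_of i) (col_of i) = i.
Proof.
apply: ord_inj; rewrite idx_val /comp_of /row_of /col_of /compo /rowi /coli.
by have lti := ltn_ord i; rewrite !inordK /=; lia.
Qed.

Lemma idx_eq i j :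
  (i == j) = [&& comp_of i == comp_of j, row_of i == row_of j & col_of i == col_of j].
Proof.
apply/eqP/and3P => [-> // | [/eqP e1 /eqP e2 /eqP e3]].
by rewrite -(idxK i) -(idxK j) e1 e2 e3.
Qed.

(** The permutation of the basis induced by J, which exchanges the two components and transposes the
    matrices. *)
Definition Jswap (i : 'I_32) : 'I_32 := idx (rev_ord (comp_of i)) (col_of i) (row_of i).

Lemma JswapK : involutive Jswap.
Proof. by move=> i; rewrite /Jswap comp_idx row_idx col_idx rev_ordK idxK. Qed.

(** * Matrix entries of elementary tensors and of the conjugation by J *)

Section Entries.
Variable R : realType.
Local Notation C := R[i].
Implicit Types (M N : 'M[C]_32).

Lemma compo0 i : (compo i == 0%N) = (comp_of i == ord0).
Proof. by rewrite -val_eqE /comp_of /= inordK // /compo; have := ltn_ord i; lia. Qed.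

Lemma ofHE (h : H R) i :
  ofH h i ord0 = (if comp_of i == ord0 then h.1 else h.2) (row_of i) (col_of i).
Proof. by rewrite mxE compo0. Qed.

Lemma toHE (u : 'cV[C]_32) i :
  (if comp_of i == ord0 then (toH u).1 else (toH u).2) (row_of i) (col_of i) = u i ord0.
Proof.
have [e|e] := eqVneq (comp_of i) ord0; rewrite mxE; congr (u _ _).
  by rewrite -[RHS]idxK e.
rewrite -[RHS]idxK; congr (idx _ _ _).
by move: e; case: (comp_of i) => [[|[|m]] lm].
Qed.

Lemma toH_delta j :
  toH (delta_mx j ord0 : 'cV[C]_32) =
    (if comp_of j == ord0 then (delta_mx (row_of j) (col_of j), 0)
     else (0, delta_mx (row_of j) (col_of j))).
Proof.
rewrite [LHS]surjective_pairing [RHS]surjective_pairing.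
congr pair; apply/matrixP => p q.
  have := toHE (delta_mx j ord0) (idx (ord0 : 'I_2) p q).
  rewrite comp_idx row_idx col_idx eqxx => ->; rewrite mxE idx_eq.
  rewrite comp_idx row_idx col_idx andbT eq_sym.
  by case: ifP; rewrite mxE // eqxx.
have := toHE (delta_mx j ord0) (idx (ord_max : 'I_2) p q).
rewrite comp_idx row_idx col_idx (_ : (ord_max == ord0) = false) // => ->; rewrite mxE idx_eq.
rewrite comp_idx row_idx col_idx andbT eq_sym.
have -> : (comp_of j == ord_max) = (comp_of j != ord0).
  by case: (comp_of j) => [[|[|m]] lm].
by case: ifP; rewrite mxE // eqxx.
Qed.

Lemma mul_delta_mul (x y : 'M[C]_4) p' q' (a : C) p q :
  (x *m (a *: delta_mx p' q') *m y^T) p q = x p p' * a * y q q'.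
Proof.
rewrite -scalemxAr -scalemxAl mxE mulrC mulrAC; congr (_ * _).
rewrite mxE (bigD1 q') //= big1 ?addr0; last first.
  move=> k /negPf nk; rewrite mxE (bigD1 p') //= big1 ?addr0.
    by rewrite !mxE nk andbF mulr0 mul0r.
  by move=> l /negPf nl; rewrite mxE nl mulr0.
rewrite !mxE (bigD1 p') //= big1 ?addr0 ?mxE ?eqxx ?mulr1 //.
by move=> l /negPf nl; rewrite mxE nl mulr0.
Qed.

Lemma tensE (x : 'M[C]_4) m (y : 'M[C]_4) i j :
  tens x m y i j =
  x (row_of i) (row_of j) * m (comp_of i) (comp_of j) * y (col_of i) (col_of j).
Proof.
have inord2 (k : 'I_2) : k = if k == ord0 then inord 0 else inord 1.
  by apply: val_inj; case: k => [[|[|m']] lm] //=; rewrite inordK.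
rewrite mxE ofHE toH_delta [in RHS](inord2 (comp_of i)) [in RHS](inord2 (comp_of j)).
case: (comp_of i == ord0); case: (comp_of j == ord0);
by rewrite /actT /= ?scaler0 ?addr0 ?add0r mul_delta_mul.
Qed.

Lemma ofH_JH_delta j :
  ofH (JH (toH (delta_mx j ord0))) = delta_mx (Jswap j) ord0 :> 'cV[C]_32.
Proof.
apply/matrixP => i z; rewrite (ord1 z) ofHE toH_delta !mxE idx_eq.
rewrite comp_idx row_idx col_idx !andbT.
have -> : (comp_of i == rev_ord (comp_of j)) = (comp_of i == ord0) (+) (comp_of j == ord0).
  by case: (comp_of i) => [[|[|m]] lm] //; case: (comp_of j) => [[|[|m']] lm'].
case: ifP; case: ifP; rewrite /= /adj !mxE //= ?conjc0 //; try by rewrite rmorph0.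
  by rewrite andbC rmorph_nat.
by rewrite andbC rmorph_nat.
Qed.

Lemma JconjE M i j : Jconj M i j = (M (Jswap i) (Jswap j))^*.
Proof.
rewrite mxE ofH_JH_delta -colE ofHE.
have := toHE (col (Jswap j) M) (Jswap i); rewrite mxE => <-.
rewrite comp_idx row_idx col_idx /JH /adj.
by case: (comp_of i) => [[|[|m]] lm] //=; rewrite !mxE.
Qed.

(** The conjugation in the adjoint cancels the antilinearity of J, so only a transposition and the
    permutation [Jswap] remain. *)
Lemma oppE M i j : Defs.opp M i j = M (Jswap j) (Jswap i).
Proof. by rewrite JconjE !mxE conjCK. Qed.

End Entries.

(** * Decomposition of the basis into the isotypic classes of B *)

(* The class of a basis vector is the summand of B = C + M_4 + M_4 + M_3 acting
   nontrivially on it. Within a class, B acts on the row index [p], and the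
   column index [q] enumerates the multiplicity space. *)
Definition class_of (k : 'I_2) (p q : 'I_4) : nat :=
  if k == ord0 then (if q == ord0 then (if p == ord0 then 0%N else 1%N) else 2%N)
  else if p == ord0 then (if q == ord0 then 1%N else 0%N) else 3%N.

Definition class (i : 'I_32) : nat := class_of (comp_of i) (row_of i) (col_of i).

(** Each class is a rectangle, a set of rows times a set of columns, and inside a class the row and
    the column determine the component, which [comp_in] returns. *)
Definition in_class (c : nat) (p q : 'I_4) : bool :=
  match c with
  | 0 => p == ord0
  | 1 => q == ord0
  | 2 => q != ord0
  | 3 => p != ord0
  | _ => false
  end.

Definition comp_in (c : nat) (p q : 'I_4) : 'I_2 :=
  match c with
  | 0 => if q == ord0 then ord0 else ord_max
  | 1 => if p == ord0 then ord_max else ord0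
  | 2 => ord0
  | _ => ord_max
  end.

Definition cidx (c : nat) (p q : 'I_4) : 'I_32 := idx (comp_in c p q) p q.

Lemma row_cidx c p q : row_of (cidx c p q) = p.
Proof. exact: row_idx. Qed.

Lemma col_cidx c p q : col_of (cidx c p q) = q.
Proof. exact: col_idx. Qed.

Lemma class_cidx c p q : in_class c p q -> class (cidx c p q) = c.
Proof.
rewrite /class /cidx comp_idx row_idx col_idx /class_of.
by case: c => [|[|[|[|c]]]] //=; case: (p =P ord0) => //; case: (q =P ord0).
Qed.

Lemma cidxK i : cidx (class i) (row_of i) (col_of i) = i.
Proof.
rewrite -[RHS]idxK; congr (idx (nat_of_ord _) _ _); rewrite /class /class_of.
case: (comp_of i) => [[|[|m]] lm] //; apply: val_inj;
by rewrite /comp_in /=; case: (row_of i == ord0); case: (col_of i == ord0).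
Qed.

Lemma in_class_of i : in_class (class i) (row_of i) (col_of i).
Proof.
rewrite /class /class_of.
by case: (comp_of i == ord0); case: (row_of i =P ord0) => [e|/eqP ?];
   case: (col_of i =P ord0) => [e'|/eqP ?] //=; rewrite ?e ?e'.
Qed.

Lemma in_class_rect c p q p' q' : in_class c p q -> in_class c p' q' -> in_class c p q'.
Proof. by case: c => [|[|[|[|c]]]]. Qed.

Lemma class_inj i j :
  class i = class j -> row_of i = row_of j -> col_of i = col_of j -> i = j.
Proof. by move=> e e1 e2; rewrite -(cidxK i) -(cidxK j) e e1 e2. Qed.

Lemma row_Jswap i : row_of (Jswap i) = col_of i.
Proof. exact: row_idx. Qed.

Lemma col_Jswap i : col_of (Jswap i) = row_of i.
Proof. exact: col_idx. Qed.

Definition swap_class (c : nat) : nat :=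
  match c with 0 => 1 | 1 => 0 | 2 => 3 | _ => 2 end.

Lemma class_Jswap i : class (Jswap i) = swap_class (class i).
Proof.
rewrite /class row_Jswap col_Jswap comp_idx /class_of.
by case: (comp_of i) => [[|[|m]] lm] //=;
  case: (row_of i == ord0); case: (col_of i == ord0).
Qed.

Lemma class_lt i : (class i < 4)%N.
Proof. by have := in_class_of i; case: (class i) => [|[|[|[|c]]]]. Qed.

Lemma eq_class_Jswap i j : (class (Jswap i) == class (Jswap j)) = (class i == class j).
Proof.
rewrite !class_Jswap; have := class_lt i; have := class_lt j.
by case: (class i) => [|[|[|[|c]]]] //; case: (class j) => [|[|[|[|c']]]].
Qed.

(** This corner of the rectangle is the only intermediate index that contributes to a product of an
    element of B with one of B^o. *)
Lemma exists_class_row_col i j : class i = class j ->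
  exists k, [/\ class k = class i, row_of k = row_of i & col_of k = col_of j].
Proof.
move=> e; exists (cidx (class i) (row_of i) (col_of j)).
rewrite row_cidx col_cidx class_cidx //.
by have := in_class_of j; rewrite -e; apply: in_class_rect; apply: in_class_of.
Qed.

(** * The algebra B, its matrix units and its commutant *)

Section Block.
Variable R : realType.
Local Notation C := R[i].
Implicit Types (M N : 'M[C]_32) (f g : nat -> 'M[C]_4).

(* The general element of B: [f c] is its component in the summand [c], of which
   only the entries at rows of the class [c] matter. *)
Definition Phi f : 'M[C]_32 :=
  \matrix_(i, j) (if (class i == class j) && (col_of i == col_of j)
                  then f (class i) (row_of i) (row_of j) else 0).

Lemma sum_class_col i (G : 'I_4 -> C) :
  (forall r, ~~ in_class (class i) r (col_of i) -> G r = 0) ->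
  \sum_(k | (class k == class i) && (col_of k == col_of i)) G (row_of k) = \sum_r G r.
Proof.
move=> G0; rewrite [RHS](bigID (fun r => in_class (class i) r (col_of i))) /=.
rewrite [X in _ + X]big1 ?addr0 => [|r /G0 //].
rewrite (reindex_onto (fun r => cidx (class i) r (col_of i)) row_of) /=.
  apply: eq_big => [r|r _]; rewrite ?row_cidx ?eqxx ?col_cidx ?eqxx ?andbT //.
  apply/idP/idP => [/eqP e|/class_cidx -> //].
  by have := in_class_of (cidx (class i) r (col_of i)); rewrite row_cidx col_cidx e.
by move=> k /andP[/eqP <- /eqP <-]; rewrite cidxK.
Qed.

(** The product of 4 x 4 matrices sums over all four rows, the product on H only over the rows of
    the class. The hypothesis makes the surplus terms vanish. *)
Lemma PhiM f g :
  (forall i r, ~~ in_class (class i) r (col_of i) -> f (class i) (row_of i) r = 0) ->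
  Phi f *m Phi g = Phi (fun c => f c *m g c).
Proof.
move=> f0; apply/matrixP => i j; rewrite !mxE.
transitivity (\sum_(k | (class k == class i) && (col_of k == col_of i))
   f (class i) (row_of i) (row_of k) *
   (if (class i == class j) && (col_of i == col_of j)
    then g (class i) (row_of k) (row_of j) else 0)).
  rewrite [RHS]big_mkcond; apply: eq_bigr => k _; rewrite !mxE.
  rewrite [class k == class i]eq_sym [col_of k == col_of i]eq_sym.
  by case: ifP => [/andP[/eqP -> /eqP ->]|]; rewrite ?mul0r.
rewrite (sum_class_col (G := fun r => f (class i) (row_of i) r *
   (if (class i == class j) && (col_of i == col_of j) then g (class i) r (row_of j) else 0))).
  by case: ifP => _; rewrite ?mxE //; apply: big1 => r _; rewrite mulr0.
by move=> r /f0 ->; rewrite mul0r.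
Qed.

Lemma PhiD f g : Phi f + Phi g = Phi (fun c => f c + g c).
Proof. by apply/matrixP => i j; rewrite !mxE; case: ifP; rewrite ?addr0. Qed.

Lemma PhiB f g : Phi f - Phi g = Phi (fun c => f c - g c).
Proof. by apply/matrixP => i j; rewrite !mxE; case: ifP; rewrite ?subr0. Qed.

Lemma PhiZ a f : a *: Phi f = Phi (fun c => a *: f c).
Proof. by apply/matrixP => i j; rewrite !mxE; case: ifP; rewrite ?mulr0. Qed.

Lemma adj_Phi f : adj (Phi f) = Phi (fun c => adj (f c)).
Proof.
apply/matrixP => i j; rewrite !mxE eq_sym [col_of j == _]eq_sym.
by case: ifP => [/andP[/eqP -> _]|]; rewrite ?mxE ?rmorph0.
Qed.

Lemma eq_Phi f g : (forall c, (c < 4)%N -> f c = g c) -> Phi f = Phi g.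
Proof. by move=> e; apply/matrixP => i j; rewrite !mxE e ?class_lt. Qed.

Definition inB M := exists f, M = Phi f.

(** B changes rows and keeps columns, B^o changes columns and keeps rows. Within a class either
    product therefore has one possibly nonzero term at [(i, j)], through one or the other corner of
    the rectangle spanned by [i] and [j], and the two terms are equal. *)
Lemma inB_commute f g : Phi f *m Defs.opp (Phi g) = Defs.opp (Phi g) *m Phi f.
Proof.
apply/matrixP => i j; rewrite !mxE.
transitivity (if class i == class j then
    f (class i) (row_of i) (row_of j) * g (class (Jswap i)) (col_of j) (col_of i) else 0).
  case: eqP => [e|ne].
    have [k [k1 k2 k3]] := exists_class_row_col (esym e).
    rewrite (bigD1 k) //= big1 ?addr0 => [|l nl].
      rewrite oppE !mxE !eq_class_Jswap !col_Jswap !row_Jswap k1 k2 k3 e !eqxx /=.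
      by rewrite (eqP (_ : class (Jswap j) == class (Jswap i))) // eq_class_Jswap e.
    rewrite oppE !mxE !eq_class_Jswap !col_Jswap; case: ifP; last by rewrite mul0r.
    case/andP=> /eqP e1 /eqP e2; case: ifP; last by rewrite mulr0.
    case/andP=> /eqP e3 /eqP e4; case/eqP: nl; apply: class_inj; congruence.
  rewrite big1 // => l _; rewrite oppE !mxE !eq_class_Jswap.
  case: ifP; last by rewrite mul0r.
  case/andP=> /eqP e1 _; case: ifP; last by rewrite mulr0.
  by case/andP=> /eqP e2 _; case: ne; congruence.
case: eqP => [e|ne].
  have [k [k1 k2 k3]] := exists_class_row_col e.
  rewrite (bigD1 k) //= [X in _ + X]big1 ?addr0 => [|l nl].
    rewrite oppE !mxE !eq_class_Jswap !col_Jswap !row_Jswap k1 k2 k3 e !eqxx /= mulrC.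
    rewrite (eqP (_ : class (Jswap i) == class (Jswap j))) ?eq_class_Jswap ?e ?eqxx //.
    by rewrite (eqP (_ : class (Jswap k) == class (Jswap j))) // eq_class_Jswap k1 e.
  rewrite oppE !mxE !eq_class_Jswap !col_Jswap; case: ifP; last by rewrite mul0r.
  case/andP=> /eqP e1 /eqP e2; case: ifP; last by rewrite mulr0.
  case/andP=> /eqP e3 /eqP e4; case/eqP: nl; apply: class_inj; congruence.
rewrite big1 // => l _; rewrite oppE !mxE !eq_class_Jswap.
case: ifP; last by rewrite mul0r.
case/andP=> /eqP e1 _; case: ifP; last by rewrite mulr0.
by case/andP=> /eqP e2 _; case: ne; congruence.
Qed.

(** A matrix unit of the summand [c], repeated along the multiplicity space. It is zero if one of
    its two rows lies outside the class. *)
Definition Munit c p p' : 'M[C]_32 := Phi (fun d => if d == c then delta_mx p p' else 0).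

Lemma MunitE c p p' i j :
  Munit c p p' i j =
    [&& class i == c, class j == c, col_of i == col_of j, row_of i == p & row_of j == p']%:R.
Proof.
rewrite !mxE; case: (class i =P c) => [->|ne] /=.
  by rewrite [c == _]eq_sym; case: (class j == c) => //=; case: (col_of i == _); rewrite ?mxE.
by case: ifP; rewrite ?mxE.
Qed.

Lemma Munit_mulE i0 p (M : 'M[C]_32) j : in_class (class i0) p (col_of i0) ->
  (Munit (class i0) (row_of i0) p *m M) i0 j = M (cidx (class i0) p (col_of i0)) j.
Proof.
move=> v; rewrite mxE (bigD1 (cidx (class i0) p (col_of i0))) //= big1 ?addr0 => [|k nk].
  by rewrite MunitE class_cidx // row_cidx col_cidx !eqxx mul1r.
rewrite MunitE; case: and5P => [[_ /eqP e1 /eqP e2 _ /eqP e3]|]; last by rewrite mul0r.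
by case/eqP: nk; rewrite -(cidxK k) e1 -e2 e3.
Qed.

Lemma mulE_Munit j0 p (M : 'M[C]_32) i : in_class (class j0) p (col_of j0) ->
  (M *m Munit (class j0) p (row_of j0)) i j0 = M i (cidx (class j0) p (col_of j0)).
Proof.
move=> v; rewrite mxE (bigD1 (cidx (class j0) p (col_of j0))) //= big1 ?addr0 => [|k nk].
  by rewrite MunitE class_cidx // row_cidx col_cidx !eqxx mulr1.
rewrite MunitE; case: and5P => [[/eqP e1 _ /eqP e2 /eqP e3 _]|]; last by rewrite mulr0.
by case/eqP: nk; rewrite -(cidxK k) e1 e2 e3.
Qed.

(** This gives the inclusion of B' in B^o. An operator commuting with the matrix units acts on the
    multiplicity spaces only, and [opp] turns these into the row spaces on which B acts. *)
Lemma commutant_inB M :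
  (forall i p, in_class (class i) p (col_of i) ->
     M *m Munit (class i) (row_of i) p = Munit (class i) (row_of i) p *m M) ->
  inB (Defs.opp M).
Proof.
move=> cM.
(* Commutation with the diagonal units: [M] preserves the class and the row. *)
have Mz i j : ~~ ((class i == class j) && (row_of i == row_of j)) -> M i j = 0.
  move=> nij; have := congr1 (fun A : 'M_32 => A i j) (cM i (row_of i) (in_class_of i)).
  rewrite /= Munit_mulE ?in_class_of // cidxK => <-.
  rewrite mxE big1 // => k _; rewrite MunitE.
  case: and5P => [[_ /eqP e2 _ _ /eqP e3]|]; last by rewrite mulr0.
  by rewrite e2 e3 !eqxx in nij.
(* Commutation with the unit that links the row of [i] to [p]: the entries of [M] depend on the
   columns alone. *)
have Mt i j c p : class i = c -> class j = c -> row_of i = row_of j ->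
    in_class c p (col_of i) -> in_class c p (col_of j) ->
    M i j = M (cidx c p (col_of i)) (cidx c p (col_of j)).
  move=> ei ej eij vi vj; subst c.
  have := congr1 (fun A : 'M_32 => A i (cidx (class i) p (col_of j))) (cM i p vi).
  rewrite /= Munit_mulE // => <-.
  set k := cidx _ _ _; have ck : class k = class i by rewrite class_cidx.
  have rk : row_of k = p by rewrite row_cidx.
  have lk : col_of k = col_of j by rewrite col_cidx.
  have := @mulE_Munit k (row_of i) M i; rewrite ck rk lk => -> //.
    by rewrite eij -ej cidxK.
  by rewrite eij -ej in_class_of.
(* A reference row in each class. Class 3 has no row 0, hence row 1 there. *)
pose row0 c : 'I_4 := if c is 3 then inord 1 else ord0.
exists (fun c => \matrix_(q, q') M (cidx (swap_class c) (row0 (swap_class c)) q')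
                     (cidx (swap_class c) (row0 (swap_class c)) q)).
apply/matrixP => i j; rewrite oppE mxE.
case: ifP => [/andP[/eqP e1 /eqP e2]|/negbT n]; last first.
  by apply: Mz; rewrite eq_class_Jswap !row_Jswap eq_sym [col_of j == _]eq_sym.
rewrite mxE -class_Jswap -!(col_Jswap) //.
have e3 : class (Jswap j) = class (Jswap i) by apply/eqP; rewrite eq_class_Jswap e1.
have row0P k : in_class (class k) (row0 (class k)) (col_of k).
  have := in_class_of k; case: (class k) => [|[|[|[|c]]]] //= _.
  by rewrite -val_eqE /= inordK.
apply: Mt => //; rewrite ?row_Jswap //.
by rewrite -e3.
Qed.
End Block.

(** * The algebra A and its complexification inside B *)

Section Clifford.
Variable R : realType.
Local Notation C := R[i].
Implicit Types (M N T : 'M[C]_32) (x y : 'M[C]_4).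

Definition tab4 (s : seq (seq C)) : 'M[C]_4 := \matrix_(p, q) nth 0 (nth [::] s p) q.

Lemma Xmat_tab4 (a b c d : C) :
  Xmat (mat2 a b c d) =
  tab4 [:: [:: 0; 0; a; b]; [:: 0; 0; c; d];
           [:: a^*; c^*; 0; 0]; [:: b^*; d^*; 0; 0]].
Proof.
apply/matrixP => p q; rewrite [RHS]mxE mxE.
by case: splitP => k /= ->; rewrite mxE; case: splitP => l /= ->; rewrite !mxE;
  case: k => [[|[|k]] lk] //; case: l => [[|[|l]] ll].
Qed.

Lemma diag_lam_lamc_q_tab4 (lam z w : C) :
  diag_lam_lamc_q lam z w =
  tab4 [:: [:: lam; 0; 0; 0]; [:: 0; lam^*; 0; 0];
           [:: 0; 0; z; w]; [:: 0; 0; - w^*; z^*]].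
Proof.
apply/matrixP => p q; rewrite [RHS]mxE mxE.
by case: splitP => k /= ->; rewrite mxE; case: splitP => l /= ->; rewrite !mxE;
  case: k => [[|[|k]] lk] //; case: l => [[|[|l]] ll].
Qed.

Lemma diag_lam_mE (lam : C) (m : 'M[C]_3) (p q : 'I_4) :
  diag_lam_m lam m p q =
  if p == ord0 then (if q == ord0 then lam else 0)
  else if q == ord0 then 0 else m (inord p.-1) (inord q.-1).
Proof.
rewrite mxE -![_ == ord0]val_eqE /=.
case: splitP => k /= ->; rewrite mxE; case: splitP => l /= ->; rewrite ?(ord1 k) ?(ord1 l) ?mxE //.
by congr (m _ _); apply: val_inj; rewrite /= inordK // ltn_ord.
Qed.

Lemma e2_entry (a b : 'I_2) (i j : nat) : (0 < i)%N -> (0 < j)%N -> (i < 3)%N -> (j < 3)%N ->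
  e2 R i j a b = ((a == i.-1 :> nat) && (b == j.-1 :> nat))%:R.
Proof. by case: i j => [|i] [|j] // _ _ li lj; rewrite mxE -!val_eqE /= !inordK. Qed.

Lemma e4_entry (a b : 'I_4) : e4 R 1 1 a b = ((a == ord0) && (b == ord0))%:R.
Proof. by rewrite mxE -!val_eqE /= !inordK. Qed.

Definition left_op x y : 'M[C]_32 := tens x (e2 R 1 1) 1%:M + tens y (e2 R 2 2) 1%:M.

(* The pairs [(x, y)] with [left_op x y] in the complexification of A: the
   entries standing for lambda and its conjugate become independent, and the
   quaternion becomes an arbitrary 2 x 2 block. *)
Definition block_form x y :=
  [/\ (forall p, p != ord0 -> [/\ x ord0 p = 0, x p ord0 = 0, y ord0 p = 0 & y p ord0 = 0]),
      x ord0 ord0 = y ord0 ord0 &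
      forall p, p != inord 1 -> x (inord 1) p = 0 /\ x p (inord 1) = 0].

(** Classes 0 and 1 meet both components of H, but one of the two components enters only through row
    0, where [x] and [y] have the same corner entry. A single matrix thus serves the whole class. *)
Definition block_fun x y (c : nat) := if (c == 0%N) || (c == 3%N) then y else x.

Lemma left_opE x y i j :
  left_op x y i j =
  x (row_of i) (row_of j) * ((comp_of i == ord0) && (comp_of j == ord0))%:R *
    (col_of i == col_of j)%:R +
  y (row_of i) (row_of j) * ((comp_of i == ord_max) && (comp_of j == ord_max))%:R *
    (col_of i == col_of j)%:R.
Proof.
by rewrite mxE; congr (_ + _); rewrite tensE e2_entry // [1%:M _ _]mxE.
Qed.

Lemma left_op_Phi x y : block_form x y -> left_op x y = Phi (block_fun x y).
Proof.
case=> z0 e0 _; apply/matrixP => i j; rewrite left_opE mxE.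
have z1 := z0 (row_of i); have z2 := z0 (row_of j).
rewrite /class /class_of; move: z1 z2.
have [->|nq] := eqVneq (col_of i) (col_of j); last first.
  by rewrite !mulr0 addr0 andbF.
rewrite !mulr1 andbT.
have [ei|ni] := eqVneq (row_of i) ord0; have [ej|nj] := eqVneq (row_of j) ord0;
rewrite ?ei ?ej => z1 z2; 
case: (comp_of i) => [[|[|k]] lk] //; case: (comp_of j) => [[|[|l]] ll] //=;
case: (col_of j == ord0); rewrite /block_fun /= ?mulr0 ?mulr1 ?add0r ?addr0 //;
by [case: (z1 isT) => h1 h2 h3 h4; rewrite ?h1 ?h2 ?h3 ?h4 ?mul0r
   | case: (z2 isT) => h1 h2 h3 h4; rewrite ?h1 ?h2 ?h3 ?h4 ?mul0r].
Qed.

Lemma real_block_form (lam z w : C) m :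
  block_form (diag_lam_lamc_q lam z w) (diag_lam_m lam m).
Proof.
have i1 : inord 1 = Ordinal (isT : 1 < 4)%N :> 'I_4 by apply: val_inj; rewrite /= inordK.
split=> [p np||p]; rewrite ?diag_lam_lamc_q_tab4 ?i1.
- by rewrite !diag_lam_mE !mxE eqxx (negPf np); case: p np => [[|[|[|[|p]]]] lp].
- by rewrite diag_lam_mE mxE.
by rewrite !mxE; case: p => [[|[|[|[|p]]]] lp].
Qed.

Lemma inA_block a : inA a -> exists x y, block_form x y /\ a = Phi (block_fun x y).
Proof.
case=> lam [z [w [m ->]]].
exists (diag_lam_lamc_q lam z w), (diag_lam_m lam m); split; first exact: real_block_form.
by rewrite -left_op_Phi //; apply: real_block_form.
Qed.

(** Conjugating the second equation gives u - iv = b^*, and the linear system has the solution used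
    as witness. A scalar and its conjugate thus become independent after complexification. *)
Lemma complex_split (a b : C) : exists u v : C, u + 'i * v = a /\ u^* + 'i * v^* = b.
Proof.
have iI (u : C) : 'i * (- 'i * u) = u.
  by rewrite mulrA mulrN -expr2 sqrCi opprK mul1r.
exists ((a + b^*) / 2), (- 'i * ((a - b^*) / 2)).
rewrite !(rmorphM, rmorphB, rmorphD, rmorphN) /= conjCi !conjCK fmorphV rmorph_nat opprK.
rewrite iI -[X in _ + 'i * X]opprK -mulNr mulrN iI.
by have n2 : (2 : C) != 0 by [rewrite pnatr_eq0]; split; field.
Qed.

Lemma block_complexify x y : block_form x y ->
  exists a a', [/\ inA a, inA a' & Phi (block_fun x y) = a + 'i *: a'].
Proof.
move=> h; have [z0 e0 z1] := h.
have i1 : inord 1 = Ordinal (isT : 1 < 4)%N :> 'I_4 by apply: val_inj; rewrite /= inordK.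
pose o2 : 'I_4 := Ordinal (isT : 2 < 4)%N; pose o3 : 'I_4 := Ordinal (isT : 3 < 4)%N.
have [l [l' [el el']]] := complex_split (x ord0 ord0) (x (inord 1) (inord 1)).
have [z [z' [ez ez']]] := complex_split (x o2 o2) (x o3 o3).
(* The lower left entry of a quaternion is the opposite of the conjugate of [w], hence the sign. *)
have [w [w' [ew ew']]] := complex_split (x o2 o3) (- x o3 o2).
(* The summand M_3(C) is already complex, so all of it goes into the first operator and the second
   one takes 0. *)
pose m : 'M[C]_3 := \matrix_(p, q) y (inord p.+1) (inord q.+1).
exists (left_op (diag_lam_lamc_q l z w) (diag_lam_m l m)),
  (left_op (diag_lam_lamc_q l' z' w') (diag_lam_m l' 0)).
split; [by exists l, z, w, m | by exists l', z', w', 0 | ].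
rewrite !left_op_Phi; try exact: real_block_form.
rewrite PhiZ PhiD; apply: eq_Phi => c _; rewrite /block_fun.
case: ifP => _; apply/matrixP => p q.
  rewrite mxE [X in _ + X]mxE !diag_lam_mE.
  have [->|np] := eqVneq p ord0; have [->|nq] := eqVneq q ord0; rewrite ?mulr0 ?addr0.
  - by rewrite el -e0.
  - by case: (z0 q nq).
  - by case: (z0 p np).
  rewrite !mxE mulr0 addr0; congr (y _ _); apply: val_inj;
    by move: np nq; case: p => [[|[|[|[|p]]]] lp] //; case: q => [[|[|[|[|q]]]] lq] //;
       rewrite /= !inordK.
rewrite !diag_lam_lamc_q_tab4 !mxE.
have x0 r : r != ord0 -> x ord0 r = 0 /\ x r ord0 = 0 by move=> /z0[].
move: z1 x0; rewrite i1 => z1 x0.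
have [->|n0] := eqVneq p ord0.
  have [->|m0] := eqVneq q ord0; first by rewrite /= el.
  by have [-> _] := x0 q m0; move: m0; case: q => [[|[|[|[|q]]]] lq] //=; rewrite mulr0 addr0.
have [->|m0] := eqVneq q ord0.
  by have [_ ->] := x0 p n0; move: n0; case: p => [[|[|[|[|p]]]] lp] //=; rewrite mulr0 addr0.
have [->|n1] := eqVneq p (Ordinal (isT : 1 < 4)%N).
  have [->|m1] := eqVneq q (Ordinal (isT : 1 < 4)%N); first by rewrite /= el' i1.
  by have [-> _] := z1 q m1; move: m0 m1; case: q => [[|[|[|[|q]]]] lq] //=; rewrite mulr0 addr0.
have [->|m1] := eqVneq q (Ordinal (isT : 1 < 4)%N).
  by have [_ ->] := z1 p n1; move: n0 n1; case: p => [[|[|[|[|p]]]] lp] //=; rewrite mulr0 addr0.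
have o23 r : r != ord0 -> r != Ordinal (isT : 1 < 4)%N -> r = o2 \/ r = o3.
  by case: r => [[|[|[|[|r]]]] lr] // _ _; [left | right]; apply: val_inj.
have [->|->] := o23 p n0 n1; have [->|->] := o23 q m0 m1; rewrite /= ?ez ?ez' ?ew //.
by rewrite mulrN -opprD ew' opprK.
Qed.

(** * The three parts of the Dirac operator relative to A and B *)

Lemma adjK m n (M : 'M[C]_(m, n)) : adj (adj M) = M.
Proof. by apply/matrixP => i j; rewrite !mxE conjCK. Qed.

Lemma Jconj_opp M : Jconj M = Defs.opp (adj M).
Proof. by rewrite /Defs.opp adjK. Qed.

Lemma oppK M : Defs.opp (Defs.opp M) = M.
Proof. by apply/matrixP => i j; rewrite !oppE !JswapK. Qed.

Definition dirac_block (G B : 'M[C]_4) (c : nat) : 'M[C]_4 :=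
  if c == 1%N then G else if c == 2%N then B else 0.

Lemma D0E (X B Y : 'M[C]_4) i j :
  D0 X B Y i j =
  X (row_of i) (row_of j) * e2 R 1 1 (comp_of i) (comp_of j) *
    e4 R 1 1 (col_of i) (col_of j) +
  B (row_of i) (row_of j) * e2 R 1 1 (comp_of i) (comp_of j) *
    (1%:M - e4 R 1 1) (col_of i) (col_of j) +
  Y (row_of i) (row_of j) * e2 R 1 2 (comp_of i) (comp_of j) *
    e4 R 1 1 (col_of i) (col_of j) +
  adj Y (row_of i) (row_of j) * e2 R 2 1 (comp_of i) (comp_of j) *
    e4 R 1 1 (col_of i) (col_of j).
Proof.
have entryD (M N : 'M[C]_32) : (M + N) i j = M i j + N i j by rewrite mxE.
by rewrite /D0 !entryD; congr (_ + _ + _ + _); exact: tensE.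
Qed.

(** In column 0, [X] decouples row 0 of the first component. Its place in class 1 is taken by row 0
    of the second component, which the first column of [Y] couples to the other rows. *)
Lemma D0_Phi (X B Y : 'M[C]_4) :
  (forall p, X ord0 p = 0 /\ X p ord0 = 0) ->
  (forall p q, (p == ord0) || (q != ord0) -> Y p q = 0) ->
  D0 X B Y = Phi (dirac_block (X + Y + adj Y) B).
Proof.
move=> X0 Y0.
apply/matrixP => i j; rewrite D0E [RHS]mxE !e2_entry //= e4_entry.
rewrite [(1%:M - _) _ _]mxE [(- e4 R 1 1)%R _ _]mxE e4_entry [adj Y _ _]mxE [1%:M _ _]mxE.
have X1 := X0 (row_of i); have X2 := X0 (row_of j).
have Y1 := Y0 (row_of i) (row_of j); have Y2 := Y0 (row_of j) (row_of i).
rewrite /class /class_of; move: X1 X2 Y1 Y2.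
have [->|nq] := eqVneq (col_of i) (col_of j); last first.
  have -> : (col_of i == ord0) && (col_of j == ord0) = false.
    by apply/negP => /andP[/eqP e /eqP e']; rewrite e e' eqxx in nq.
  by rewrite subr0 !mulr0 !addr0 andbF.
rewrite andbb andbT.
have [ei|ni] := eqVneq (row_of i) ord0; have [ej|nj] := eqVneq (row_of j) ord0;
rewrite ?ei ?ej ?eqxx /= => -[x1 x2] [x3 x4] y1 y2;
rewrite ?(y1 isT) ?(y2 isT) ?mxE ?conjC0;
case: (comp_of i) => [[|[|k]] lk] //; case: (comp_of j) => [[|[|l]] ll] //=;
case: (col_of j == ord0); rewrite /= /dirac_block /= ?(mulr0, mulr1, add0r, addr0, subrr, subr0) ?mxE
  ?x1 ?x2 ?x3 ?x4 ?(y1 isT) ?(y2 isT) ?mxE ?rmorph0 ?(add0r, addr0) //.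
Qed.

(** D_R lives on the two basis vectors of row and column 0, and there the left operator is the
    scalar [x ord0 ord0], the common corner of [x] and [y]. *)
Lemma DR_commute (ups : C) x y : block_form x y ->
  DR ups *m left_op x y = left_op x y *m DR ups.
Proof.
case=> z0 e0 _.
pose o i := (row_of i == ord0) && (col_of i == ord0).
have DR0 i j : ~~ (o i && o j) -> DR ups i j = 0.
  rewrite tensE !e4_entry /o; case: (row_of i == ord0); case: (row_of j == ord0);
  by case: (col_of i == ord0); case: (col_of j == ord0); rewrite ?mulr0 ?mul0r.
have L0 i j : o i || o j -> left_op x y i j = x ord0 ord0 * (i == j)%:R.
  rewrite left_opE idx_eq /o.
  have z1 := z0 (row_of i); have z2 := z0 (row_of j).
  move: z1 z2; have [ei|ni] := eqVneq (row_of i) ord0; have [ej|nj] := eqVneq (row_of j) ord0;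
  rewrite ?ei ?ej ?eqxx //= => z1 z2 h; rewrite -?e0.
  - case: (comp_of i) => [[|[|k]] lk] //; case: (comp_of j) => [[|[|l]] ll] //=;
    by case: (col_of i == _); rewrite ?(mulr0, mulr1, addr0, add0r).
  - by case: (z2 isT) => -> _ -> _; rewrite [ord0 == _]eq_sym (negPf nj) andbF !mul0r mulr0 addr0.
  - by case: (z1 isT) => _ -> _ ->; rewrite (negPf ni) andbF !mul0r mulr0 addr0.
have DL i j : (DR ups *m left_op x y) i j = x ord0 ord0 * DR ups i j.
  rewrite mxE (bigD1 j) //= big1 ?addr0 => [|k nk].
    have [oj|oj] := boolP (o j); first by rewrite L0 ?oj // eqxx mulr1 mulrC.
    by rewrite DR0 ?mul0r ?mulr0 // negb_and oj orbT.
  have [ok|ok] := boolP (o k); first by rewrite L0 ?ok // (negPf nk) !mulr0.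
  by rewrite DR0 ?mul0r // negb_and ok orbT.
have LD i j : (left_op x y *m DR ups) i j = x ord0 ord0 * DR ups i j.
  rewrite mxE (bigD1 i) //= big1 ?addr0 => [|k nk].
    have [oj|oj] := boolP (o i); first by rewrite L0 ?oj // eqxx mulr1.
    by rewrite DR0 ?mulr0 // negb_and oj.
  have [ok|ok] := boolP (o k).
    by rewrite L0 ?ok ?orbT // eq_sym (negPf nk) mulr0 mul0r.
  by rewrite DR0 ?mulr0 // negb_and ok.
by apply/matrixP => i j; rewrite DL LD.
Qed.

(** * Generated star-algebras, and commutation with diagonal projections *)

Section Generated.
Variable S : 'M[C]_32 -> Prop.
Local Notation Cl := (gen_star_alg S).

(** The element [x0] supplies the zero of the algebra, as its multiple by 0. *)
Lemma gsa_sum (I : finType) (F : I -> 'M[C]_32) (x0 : 'M[C]_32) :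
  Cl x0 -> (forall i, Cl (F i)) -> Cl (\sum_i F i).
Proof.
move=> h0 hF; apply: (big_ind Cl) => [|M N hM hN|i _]; last exact: hF.
  by rewrite -(scale0r x0); apply: gsa_scale.
exact: gsa_add.
Qed.

Lemma gsa_sub M N : Cl M -> Cl N -> Cl (M - N).
Proof. by move=> hM hN; rewrite -scaleN1r; apply: gsa_add => //; apply: gsa_scale. Qed.

Lemma gsa_unscale (a : C) M : a != 0 -> Cl (a *: M) -> Cl M.
Proof. by move=> na h; rewrite -[M]scale1r -(mulVf na) -scalerA; apply: gsa_scale. Qed.

Lemma Phi_sum f :
  Phi f = \sum_(c < 4) \sum_p \sum_q f c p q *: Munit R c p q.
Proof.
apply/matrixP => i j; rewrite summxE.
under eq_bigr do (rewrite summxE; under eq_bigr do rewrite summxE).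
rewrite mxE (bigD1 (Ordinal (class_lt i))) //= [X in _ + X]big1 ?addr0 => [|c nc]; last first.
  rewrite big1 // => p _; rewrite big1 // => q _; rewrite mxE MunitE.
  have -> : (class i == c) = false by apply/negP => /eqP e; case/eqP: nc; apply: val_inj.
  by rewrite mulr0.
rewrite (bigD1 (row_of i)) //= [X in _ + X]big1 ?addr0 => [|p np]; last first.
  by rewrite big1 // => q _; rewrite mxE MunitE [row_of i == p]eq_sym (negPf np) !andbF mulr0.
rewrite (bigD1 (row_of j)) //= [X in _ + X]big1 ?addr0 => [|q nq]; last first.
  by rewrite mxE MunitE [row_of j == q]eq_sym (negPf nq) !andbF mulr0.
rewrite mxE MunitE !eqxx !andbT /= [class j == _]eq_sym.
by case: (_ && _); rewrite ?mulr1 ?mulr0.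
Qed.

Lemma gsa_inB M : (forall c p q, Cl (Munit R c p q)) -> inB M -> Cl M.
Proof.
move=> hU [f ->]; rewrite Phi_sum; have h0 := hU 0%N ord0 ord0.
do 3!(apply: (gsa_sum h0) => ?); exact: gsa_scale.
Qed.

(** Self-adjointness of [T] carries commutation with [M] over to the adjoint of [M]. *)
Lemma gsa_commute T : adj T = T -> (forall M, S M -> T *m M = M *m T) ->
  forall M, Cl M -> T *m M = M *m T.
Proof.
move=> aT cT M; elim=> {M} [M /cT //|M N _ hM _ hN|a M _ hM|M N _ hM _ hN|M _ hM].
- by rewrite mulmxDl mulmxDr hM hN.
- by rewrite -scalemxAl -scalemxAr hM.
- by rewrite mulmxA hM -!mulmxA hN.
have adjM (A B : 'M[C]_32) : adj (A *m B) = adj B *m adj A by rewrite /adj map_mxM trmx_mul.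
by rewrite -aT -!adjM hM.
Qed.

End Generated.

Lemma inB_mul M N : inB M -> inB N -> inB (M *m N).
Proof.
move=> [f ->] [g ->].
(* The entries of [f] that [Phi] ignores must vanish for [PhiM] to apply. *)
pose cut c : 'M[C]_4 := \matrix_(p, q)
  if ((c == 0%N) && (q != ord0)) || ((c == 3%N) && (q == ord0)) then 0 else f c p q.
have -> : Phi f = Phi cut.
  apply/matrixP => i j; rewrite !mxE; case: ifP => // /andP[/eqP e _].
  have := in_class_of j; rewrite -e; case: (class i) => [|[|[|[|c]]]] //=.
    by move=> ->.
  by move=> /negPf ->.
rewrite PhiM; first by exists (fun c => cut c *m g c).
move=> i r; rewrite mxE; case: (class i) (in_class_of i) => [|[|[|[|c]]]] //= h.
- by move=> ->.
- by rewrite h.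
- by rewrite h.
- by rewrite negbK => ->.
Qed.

Lemma inB_gsa S : (forall M, S M -> inB M) -> forall M, gen_star_alg S M -> inB M.
Proof.
move=> hS M; elim=> {M} [M /hS //|M N _ [f ->] _ [g ->]|a M _ [f ->]|M N _ hM _ hN|M _ [f ->]].
- by rewrite PhiD; eexists.
- by rewrite PhiZ; eexists.
- exact: inB_mul.
- by rewrite adj_Phi; eexists.
Qed.

Lemma commute_diag (t : 'I_32 -> bool) M :
  (\matrix_(i, j) ((i == j) && t i)%:R *m M = M *m \matrix_(i, j) ((i == j) && t i)%:R) <->
  (forall i j, t i != t j -> M i j = 0).
Proof.
have e1 i j : (\matrix_(i, j) ((i == j) && t i)%:R *m M) i j = (t i)%:R * M i j.
  rewrite mxE (bigD1 i) //= big1 ?addr0 => [|k nk]; rewrite mxE ?eqxx //.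
  by rewrite eq_sym (negPf nk) mul0r.
have e2' i j : (M *m \matrix_(i, j) ((i == j) && t i)%:R) i j = (t j)%:R * M i j.
  rewrite mxE (bigD1 j) //= big1 ?addr0 => [|k nk]; rewrite mxE ?eqxx 1?mulrC //.
  by rewrite (negPf nk) mul0r.
split=> [h i j nt|h].
  have := e1 i j; rewrite h e2'; move: nt.
  by case: (t i); case: (t j) => //= _; rewrite mul0r mul1r.
apply/matrixP => i j; rewrite e1 e2'.
by case: eqP (h i j) => [-> //|/eqP nt ->] //; rewrite !mulr0.
Qed.

Lemma block_form_off x y (p q : 'I_4) :
  block_form x y -> (p < 2)%N || (q < 2)%N -> p != q -> x p q = 0.
Proof.
case=> z0 _ z1.
have i1 : inord 1 = Ordinal (isT : 1 < 4)%N :> 'I_4 by apply: val_inj; rewrite /= inordK.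
have lt2 (r : 'I_4) : (r < 2)%N -> r = ord0 \/ r = inord 1.
  by rewrite i1; case: r => [[|[|r]] lr] // _; [left | right]; apply: val_inj.
case/orP=> /lt2[] -> n.
- by case: (z0 q) => //; rewrite eq_sym.
- by case: (z1 q) => //; rewrite eq_sym.
- by case: (z0 p n).
- by case: (z1 p n).
Qed.

Lemma bracket_linear (T M N : 'M[C]_32) (a : C) :
  T *m (M + a *: N) - (M + a *: N) *m T = (T *m M - M *m T) + a *: (T *m N - N *m T).
Proof. by rewrite mulmxDr mulmxDl -scalemxAl -scalemxAr scalerBr opprD addrACA. Qed.

(** * The Dirac operator of the theorem, and necessity of the four conditions *)

Section Dirac.
Variables a23 a24 b13 b14 b23 b24 d21 ups : C.

Let D := Dirac 0 0 a23 a24 b13 b14 b23 b24 0 0 0 d21 0 0 0 ups.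
Let X := Xmat (mat2 0 0 a23 a24).
Let B := Xmat (mat2 b13 b14 b23 b24).
Let Y := Ymat 0 0 0 d21 0 0 0.
(** The block of D_0 on class 1. Row 0 stands for the second component and is linked to row 1 by
    [d21]; row 1 is linked to rows 2 and 3 by [a23] and [a24]. *)
Let G := tab4 [:: [:: 0; d21^*; 0; 0]; [:: d21; 0; a23; a24];
                  [:: 0; a23^*; 0; 0]; [:: 0; a24^*; 0; 0]].

Lemma D0_block : D0 X B Y = Phi (dirac_block G B).
Proof.
rewrite D0_Phi.
- congr (Phi (dirac_block _ _)); apply/matrixP => p q.
  rewrite /X Xmat_tab4 !mxE.
  case: p => [[|[|[|[|p]]]] lp]; case: q => [[|[|[|[|q]]]] lq] //=;
  by rewrite ?conjC0 ?addr0 ?add0r.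
- move=> p; rewrite /X Xmat_tab4 !mxE.
  by case: p => [[|[|[|[|p]]]] lp] //=; rewrite ?conjC0.
move=> p q; rewrite !mxE.
by case: p => [[|[|[|[|p]]]] lp]; case: q => [[|[|[|[|q]]]] lq].
Qed.

Lemma Dirac_bracket x y : block_form x y ->
  D *m Phi (block_fun x y) - Phi (block_fun x y) *m D =
  Phi (dirac_block G B) *m Phi (block_fun x y) -
  Phi (block_fun x y) *m Phi (dirac_block G B).
Proof.
move=> h; rewrite /D /Dirac -/X -/B -/Y D0_block Jconj_opp adj_Phi.
set d0 := Phi (dirac_block G B); set b := Phi (block_fun x y); set d1 := Defs.opp _.
have c1 : d1 *m b = b *m d1 by rewrite /b inB_commute.
have c2 : DR ups *m b = b *m DR ups by rewrite /b -left_op_Phi // DR_commute.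
by rewrite !mulmxDl !mulmxDr c1 c2 !opprD addrACA subrr addr0 addrACA subrr addr0.
Qed.

Lemma ClD_inB M : ClD D M -> inB M.
Proof.
apply: inB_gsa => {}M [/inA_block[x [y [_ ->]]]|]; first by eexists.
case=> a [b [/inA_block[x [y [_ ->]]] [/inA_block[x' [y' [h ->]]] ->]]].
rewrite Dirac_bracket //; apply: inB_mul; first by eexists.
have [f ->] : inB (Phi (dirac_block G B) *m Phi (block_fun x' y')) by apply: inB_mul; eexists.
have [g ->] : inB (Phi (block_fun x' y') *m Phi (dirac_block G B)) by apply: inB_mul; eexists.
by rewrite PhiB; eexists.
Qed.

(** The predicate [s] is a set of rows that does not separate rows 2 and 3, which the quaternions
    mix, and that the block of D_0 leaves invariant. The projection [T] onto these rows of class [c]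
    then commutes with Cl_D(A). The common column [r] guarantees that the unit linking [p] to [q] is
    not zero. *)
Lemma Hodge_connected (c : nat) (s : pred 'I_4) (p q r : 'I_4) :
  Hodge D -> (c == 1%N) || (c == 2%N) ->
  (forall p q : 'I_4, s p != s q -> (p < 2)%N || (q < 2)%N) ->
  (forall p q, s p != s q -> dirac_block G B c p q = 0) ->
  in_class c p r -> in_class c q r -> s p = s q.
Proof.
move=> hodge c12 s2 sD inp inq.
pose t i := (class i == c) && s (row_of i).
pose T : 'M[C]_32 := \matrix_(i, j) ((i == j) && t i)%:R.
have cPhi (f : nat -> 'M[C]_4) : (forall p q, s p != s q -> f c p q = 0) -> T *m Phi f = Phi f *m T.
  move=> f0; apply/commute_diag => i j; rewrite mxE /t.
  case: ifP => // /andP[/eqP <- _]; case: (class i =P c) => //= -> nij.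
  exact: f0.
have cA a : inA a -> T *m a = a *m T.
  case/inA_block=> x [y [h ->]]; apply: cPhi => p' q' n.
  have -> : block_fun x y c = x by move: c12; rewrite /block_fun; case: (c) => [|[|[|]]].
  apply: (block_form_off h (s2 _ _ n)).
  by apply/eqP => e; rewrite e eqxx in n.
have cT M : ClD D M -> T *m M = M *m T.
  apply: gsa_commute => [|{}M [/cA //|]].
    apply/matrixP => i j; rewrite !mxE rmorph_nat eq_sym.
    by case: eqP => // ->.
  case=> a [b [Aa [Ab ->]]].
  have [x [y [h eb]]] := inA_block Ab.
  (* [T] passes through [a]; in the bracket, [D] may be replaced by D_0, which commutes with [T]. *)
  rewrite mulmxA cA // -!mulmxA; congr (_ *m _); rewrite {2 3}eb.
  have cb := cA _ Ab; have cD := cPhi (dirac_block G B) sD.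
  rewrite eb in cb *; rewrite Dirac_bracket // mulmxBr mulmxBl.
  by rewrite mulmxA cD -!mulmxA cb !mulmxA cb -!mulmxA cD.
(* The Hodge property puts [T] in B^o, so it commutes with the matrix unit from [q] to [p]. *)
have [eta [Cleta eT]] : opp_set (ClD D) T by apply/hodge => M /cT.
have [f ef] := ClD_inB Cleta.
have /commute_diag cU : T *m Munit R c p q = Munit R c p q *m T.
  by rewrite eT ef /Munit inB_commute.
apply/eqP/negPn/negP => npq.
(* This entry of the unit is 1, yet it must vanish if [s] separates [p] from [q]. *)
have := cU (cidx c p r) (cidx c q r).
rewrite MunitE /t !class_cidx // !row_cidx !col_cidx !eqxx /= => /(_ npq).
by apply/eqP; rewrite oner_eq0.
Qed.

(** Read a block of D_0 as a graph on the rows. Each failing condition detaches a set of rows: {0}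
    or {2, 3} in class 1, {0} or {1} in class 2. The column is 0 for class 1 and a nonzero one for
    class 2, as the classes require. *)
Lemma Hodge_necessary : Hodge D ->
  [/\ d21 != 0, (a23, a24) != (0, 0), (b13, b14) != (0, 0) & (b23, b24) != (0, 0)].
Proof.
move=> hodge.
pose o0 : 'I_4 := ord0; pose o1 : 'I_4 := Ordinal (isT : 1 < 4)%N.
pose o2 : 'I_4 := Ordinal (isT : 2 < 4)%N.
have B_tab := Xmat_tab4 b13 b14 b23 b24.
split; apply/eqP.
- move=> e.
  suff : (o0 == o0) = (o1 == o0) by [].
  apply: (@Hodge_connected 1 (pred1 o0) o0 o1 o0 hodge) => // p q;
    rewrite /dirac_block /= ?mxE ?e ?conjC0;
    by case: p => [[|[|[|[|p]]]] lp]; case: q => [[|[|[|[|q]]]] lq].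
- case=> e e'.
  suff : (2 <= o1)%N = (2 <= o2)%N by [].
  apply: (@Hodge_connected 1 (fun p : 'I_4 => (2 <= p)%N) o1 o2 o0 hodge) => // p q;
    rewrite /dirac_block /= ?mxE ?e ?e' ?conjC0;
    by case: p => [[|[|[|[|p]]]] lp]; case: q => [[|[|[|[|q]]]] lq].
- case=> e e'.
  suff : (o0 == o0) = (o1 == o0) by [].
  apply: (@Hodge_connected 2 (pred1 o0) o0 o1 o1 hodge) => // p q;
    rewrite /dirac_block /= /B ?B_tab ?mxE ?e ?e' ?conjC0;
    by case: p => [[|[|[|[|p]]]] lp]; case: q => [[|[|[|[|q]]]] lq].
case=> e e'.
suff : (o1 == o1) = (o0 == o1) by [].
apply: (@Hodge_connected 2 (pred1 o1) o1 o0 o1 hodge) => // p q;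
  rewrite /dirac_block /= /B ?B_tab ?mxE ?e ?e' ?conjC0;
  by case: p => [[|[|[|[|p]]]] lp]; case: q => [[|[|[|[|q]]]] lq].
Qed.

(** * Generation of the matrix units of B, and sufficiency *)

Lemma ClD_block x y : block_form x y -> ClD D (Phi (block_fun x y)).
Proof.
case/block_complexify => a [a' [Aa Aa' ->]].
by apply: gsa_add; [|apply: gsa_scale]; apply: gsa_base; left.
Qed.

Lemma ClD_mul_bracket x y x' y' : block_form x y -> block_form x' y' ->
  ClD D (Phi (block_fun x y) *m
         (D *m Phi (block_fun x' y') - Phi (block_fun x' y') *m D)).
Proof.
case/block_complexify => a [a' [Aa Aa' ->]].
case/block_complexify => b [b' [Ab Ab' ->]].
have gen M N : inA M -> inA N -> ClD D (M *m (D *m N - N *m D)).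
  by move=> AM AN; apply: gsa_base; right; exists M, N.
have genZ M N : inA M -> inA N -> ClD D (M *m ('i *: (D *m N - N *m D))).
  by move=> AM AN; rewrite -scalemxAr; apply: gsa_scale; apply: gen.
rewrite bracket_linear mulmxDl -scalemxAl.
by apply: gsa_add; [|apply: gsa_scale]; rewrite mulmxDr; apply: gsa_add;
   by [apply: gen | apply: genZ].
Qed.

Lemma delta_mul_delta (M : 'M[C]_4) (p r r' : 'I_4) :
  delta_mx p p *m (M *m delta_mx r r') = M p r *: delta_mx p r'.
Proof.
apply/matrixP => i j; rewrite !mxE (bigD1 p) //= big1 ?addr0 => [|k nk]; last first.
  by rewrite mxE (negPf nk) andbF mul0r.
rewrite !mxE eqxx andbT (bigD1 r) //= big1 ?addr0 => [|k nk]; last first.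
  by rewrite mxE (negPf nk) mulr0.
by rewrite mxE eqxx /= mulrCA -natrM mulnb.
Qed.

Lemma block_supported x y i r : block_form x y ->
  ~~ in_class (class i) r (col_of i) -> block_fun x y (class i) (row_of i) r = 0.
Proof.
case=> z0 _ _; have := in_class_of i.
case: (class i) => [|[|[|[|c]]]] //=; rewrite /block_fun /=.
- by move=> /eqP -> /z0[].
- by move=> ->.
- by move=> ->.
by move=> /z0[_ _ _ yi]; rewrite negbK => /eqP ->.
Qed.

Lemma dirac_supported i r :
  ~~ in_class (class i) r (col_of i) -> dirac_block G B (class i) (row_of i) r = 0.
Proof.
have := in_class_of i; case: (class i) => [|[|[|[|c]]]] //=; rewrite /dirac_block /= ?mxE //.
- by move=> ->.
- by move=> ->.
Qed.

(* Membership of e_pr in C + C + M_2(C). *)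
Definition unit_ok (p r : 'I_4) : bool := ((p < 2)%N || (r < 2)%N) ==> (p == r).

(** The second entry of a pair in [block_form] whose first entry is e_pr: it has to repeat the
    corner entry, and is zero elsewhere. *)
Definition corner_unit (p r : 'I_4) : 'M[C]_4 :=
  if (p == ord0) && (r == ord0) then delta_mx p r else 0.

Lemma block_form_unit (p r : 'I_4) : unit_ok p r ->
  block_form (delta_mx p r) (corner_unit p r).
Proof.
have i1 : inord 1 = Ordinal (isT : 1 < 4)%N :> 'I_4 by apply: val_inj; rewrite /= inordK.
rewrite /unit_ok /corner_unit; split=> [q nq||q nq]; rewrite ?i1.
- move: H nq; case: p => [[|[|[|[|p]]]] lp] //; case: r => [[|[|[|[|r]]]] lr] //;
  by case: q => [[|[|[|[|q]]]] lq] //=; split; rewrite mxE.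
- move: H; case: p => [[|[|[|[|p]]]] lp] //; case: r => [[|[|[|[|r]]]] lr] //=;
  by rewrite !mxE.
move: H nq; rewrite i1; case: p => [[|[|[|[|p]]]] lp] //; case: r => [[|[|[|[|r]]]] lr] //;
by case: q => [[|[|[|[|q]]]] lq] //=; split; rewrite mxE.
Qed.

(** Since e_pp e_rr' = 0, the product e_pp [D_0, e_rr'] reduces to e_pp D_0 e_rr', which lives on
    classes 1 and 2 because D_0 vanishes on the other two. *)
Lemma ClD_corner (p r r' : 'I_4) : (p < 2)%N -> unit_ok r r' -> p != r ->
  ClD D (G p r *: Munit R 1 p r' + B p r *: Munit R 2 p r').
Proof.
move=> p2 ok npr.
have hp : block_form (delta_mx p p) (corner_unit p p).
  by apply: block_form_unit; rewrite /unit_ok eqxx implybT.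
have hr := block_form_unit ok.
have := ClD_mul_bracket hp hr; rewrite Dirac_bracket // mulmxBr.
set e := block_fun _ _; set f := block_fun (delta_mx r r') _.
have ef0 : Phi e *m Phi f = 0.
  rewrite PhiM; last by move=> i s; apply: block_supported.
  apply/matrixP => i j; rewrite [LHS]mxE [RHS]mxE; case: ifP => // _.
  rewrite /e /f /block_fun /corner_unit.
  case: (_ || _); last by rewrite mul_delta_mx_0 // mxE.
  case: ifP => [/andP[/eqP e0 _]|_]; last by rewrite mul0mx mxE.
  by rewrite -e0 [r == p]eq_sym (negPf npr) mulmx0 mxE.
rewrite [Phi e *m (Phi f *m _)]mulmxA ef0 mul0mx subr0.
rewrite (PhiM _ (@dirac_supported)) PhiM; last by move=> i s; apply: block_supported.
rewrite /Munit !PhiZ PhiD; congr (ClD D _); apply: eq_Phi => c.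
by case: c => [|[|[|[|c]]]] // _; rewrite /dirac_block /e /f /block_fun /=
   ?mul0mx ?mulmx0 ?delta_mul_delta ?scaler0 ?addr0 ?add0r.
Qed.

Lemma Munit_mul c p q r : (c == 1%N) || (c == 2%N) ->
  Munit R c p q *m Munit R c q r = Munit R c p r.
Proof.
move=> c12; rewrite /Munit PhiM => [|i s].
  by apply: eq_Phi => d _; case: eqP; rewrite ?mul_delta_mx ?mul0mx.
have := in_class_of i; case: eqP => [->|_]; last by rewrite mxE.
by move: c12; case: (c) => [|[|[|c']]] //= _ ->.
Qed.

Lemma Munit_mul0 c d p q r s : c != d ->
  Munit R c p q *m Munit R d r s = 0.
Proof.
move=> ncd; apply/matrixP => i j; rewrite !mxE big1 // => k _; rewrite !MunitE.
case: (class k =P c) => [->|_]; last by rewrite andbF mul0r.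
by rewrite (negPf ncd) mulr0.
Qed.

Lemma adj_Munit c p q : adj (Munit R c p q) = Munit R c q p.
Proof.
apply/matrixP => i j; rewrite mxE mxE !MunitE rmorph_nat; congr (nat_of_bool _)%:R.
rewrite [col_of j == _]eq_sym; case: (class i == c); case: (class j == c) => //=.
by case: (row_of i == q); case: (row_of j == p); rewrite ?andbF.
Qed.

Lemma pair_neq0 (F : 'I_4 -> C) (a b : C) (o2 := inord 2) (o3 := inord 3) :
  F o2 = a -> F o3 = b -> (a, b) != (0, 0) -> exists2 j : 'I_4, (1 < j)%N & F j != 0.
Proof.
move=> <- <-; rewrite xpair_eqE negb_and.
by case/orP=> h; [exists o2 | exists o3]; rewrite // inordK.
Qed.

Lemma eq_Phi_in (f g : nat -> 'M[C]_4) :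
  (forall c p q r, in_class c p r -> in_class c q r -> f c p q = g c p q) -> Phi f = Phi g.
Proof.
move=> e; apply/matrixP => i j; rewrite !mxE; case: ifP => // /andP[/eqP eij /eqP er].
by apply: (e _ _ _ (col_of i)); rewrite ?in_class_of // eij er in_class_of.
Qed.

Lemma Munit_out c p q :
  (forall r, in_class c p r -> in_class c q r -> False) -> Munit R c p q = 0.
Proof.
move=> h; transitivity (Phi (fun=> 0 : 'M[C]_4)).
  apply: eq_Phi_in => d p' q' r hp hq; rewrite mxE; case: eqP => [ed|_]; last by rewrite mxE.
  rewrite mxE; case: eqP => // ep; case: eqP => // eq.
  by case: (h r); rewrite -?ed -?ep -?eq.
by apply/matrixP => i j; rewrite !mxE; case: ifP; rewrite ?mxE.
Qed.

(** Then Cl_D(A) = B, and the claim is B' = B^o: one inclusion is [inB_commute], the other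
    [commutant_inB]. *)
Lemma Hodge_inB_ClD : (forall M, inB M -> ClD D M) -> Hodge D.
Proof.
move=> hB xi; split=> [cxi|[eta [/ClD_inB[f ->] ->]] M /ClD_inB[g ->]]; last first.
  by rewrite inB_commute.
exists (Defs.opp xi); rewrite oppK; split=> //; apply: (hB).
by apply: commutant_inB => i p _; apply: cxi; apply: hB; eexists.
Qed.

(** Corners mix classes 1 and 2, so class 1 is isolated first, class 2 is obtained from it by
    subtraction, and classes 0 and 3 then come from A itself. *)
Lemma Hodge_sufficient :
  [/\ d21 != 0, (a23, a24) != (0, 0), (b13, b14) != (0, 0) & (b23, b24) != (0, 0)] ->
  Hodge D.
Proof.
case=> nd na nb1 nb2; apply: Hodge_inB_ClD => M; apply: gsa_inB => {M}.
have Bt : B = tab4 _ := Xmat_tab4 b13 b14 b23 b24.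
pose o1 : 'I_4 := inord 1.
have [j j2 nj] : exists2 j : 'I_4, (1 < j)%N & G o1 j != 0.
  by apply: (@pair_neq0 _ a23 a24); rewrite // mxE /= !inordK.
have [k k2 nk] : exists2 k : 'I_4, (1 < k)%N & B o1 k != 0.
  by apply: (@pair_neq0 _ b23 b24); rewrite // Bt mxE /= !inordK.
have [l l2 nl] : exists2 l : 'I_4, (1 < l)%N & B ord0 l != 0.
  by apply: (@pair_neq0 _ b13 b14); rewrite // Bt mxE /= !inordK.
have adjU c p q : ClD D (Munit R c p q) -> ClD D (Munit R c q p).
  by rewrite -(adj_Munit c p q); apply: gsa_adj.
have mulU c p q r : (c == 1%N) || (c == 2%N) ->
    ClD D (Munit R c p q) -> ClD D (Munit R c q r) -> ClD D (Munit R c p r).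
  by move=> c12 h h'; rewrite -(Munit_mul p q r c12); apply: gsa_mul.
have ok (r r' : 'I_4) : (1 < r)%N -> (1 < r')%N -> unit_ok r r'.
  by move=> h h'; rewrite /unit_ok [(r < 2)%N]ltnNge [(r' < 2)%N]ltnNge h h'.
have small (q : 'I_4) : [\/ q = ord0, q = o1 | (1 < q)%N].
  case: (q) => [[|[|q']] lq]; [constructor 1 | constructor 2 | constructor 3] => //;
  by apply: val_inj; rewrite /= ?inordK.
have big_neq (p q : 'I_4) : (p < 2)%N -> (1 < q)%N -> p != q.
  by move=> h h'; apply/eqP => e; move: h'; rewrite -e leqNgt h.
have o1lt : (o1 < 2)%N by rewrite inordK.
(* The entry of [B] at [(1, 0)] is zero, so this corner is [d21] times a unit of class 1 alone. *)
have U1_10 : ClD D (Munit R 1 o1 ord0).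
  have := @ClD_corner o1 ord0 ord0 o1lt isT; rewrite -val_eqE /= inordK // => /(_ isT).
  rewrite Bt !mxE /= inordK //= scale0r addr0; exact: gsa_unscale.
have U1_11 : ClD D (Munit R 1 o1 o1) by apply: mulU U1_10 (adjU _ _ _ U1_10).
have U1_1 q : ClD D (Munit R 1 o1 q).
  have [->|->|q2] := small q => //.
  (* Left multiplication by the unit (1, 1) of class 1 removes the class 2 term. *)
  have := ClD_corner o1lt (ok _ _ j2 q2) (big_neq _ _ o1lt j2).
  move=> /(gsa_mul U1_11); rewrite mulmxDr -!scalemxAr Munit_mul // Munit_mul0 //.
  by rewrite scaler0 addr0; apply: gsa_unscale.
have U1 p q : ClD D (Munit R 1 p q) by apply: mulU (adjU _ _ _ (U1_1 p)) (U1_1 q).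
(* In the complexification of A, e_11 with second entry 0 is the sum of the units (1, 1) of classes
   1 and 2. *)
have U2_11 : ClD D (Munit R 2 o1 o1).
  have h : unit_ok o1 o1 by rewrite /unit_ok eqxx implybT.
  have := gsa_sub (ClD_block (block_form_unit h)) U1_11.
  congr (ClD D _); rewrite /Munit PhiB; apply: eq_Phi => c.
  rewrite /corner_unit -val_eqE /= inordK //=.
  by case: c => [|[|[|[|c]]]] // _; rewrite /block_fun /= ?subr0 ?subrr.
have U2_1b (q : 'I_4) : (1 < q)%N -> ClD D (Munit R 2 o1 q).
  move=> q2; have := ClD_corner o1lt (ok _ _ k2 q2) (big_neq _ _ o1lt k2).
  move=> /(gsa_mul U2_11); rewrite mulmxDr -!scalemxAr Munit_mul // Munit_mul0 //.
  by rewrite scaler0 add0r; apply: gsa_unscale.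
have U2_0b (q : 'I_4) : (1 < q)%N -> ClD D (Munit R 2 ord0 q).
  move=> q2; have := @ClD_corner ord0 _ _ isT (ok _ _ l2 q2) (big_neq ord0 _ isT l2).
  (* Row 0 of [G] meets only row 1, so this corner has no class 1 term. *)
  have -> : G ord0 l = 0 by rewrite mxE; move: l2; case: (l) => [[|[|[|[|n]]]] ln].
  by rewrite scale0r add0r; apply: gsa_unscale.
have U2_1 q : ClD D (Munit R 2 o1 q).
  have [->|->|q2] := small q => //; last exact: U2_1b.
  (* Rows 1 and 0 are joined through row [k], which both reach. *)
  by apply: mulU (U2_1b _ k2) (adjU _ _ _ (U2_0b _ k2)).
have U2 p q : ClD D (Munit R 2 p q) by apply: mulU (adjU _ _ _ (U2_1 p)) (U2_1 q).
(* The element e_00 of A acts as the unit (0, 0) on classes 0, 1 and 2; class 3 has no row 0. *)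
have U0 : ClD D (Munit R 0 ord0 ord0).
  have h : unit_ok ord0 ord0 by [].
  have := gsa_sub (gsa_sub (ClD_block (block_form_unit h)) (U1 ord0 ord0)) (U2 ord0 ord0).
  congr (ClD D _); rewrite /Munit !PhiB; apply: eq_Phi_in => c p q r.
  case: c => [|[|[|[|c]]]] //; rewrite /block_fun /corner_unit /= ?subr0 ?subrr //.
  by move=> np _; rewrite !mxE (negPf np).
(* A pair with first entry 0 acts on classes 0 and 3 only, and class 0 sees only the corner entry,
   here 0. *)
have U3 p q : p != ord0 -> q != ord0 -> ClD D (Munit R 3 p q).
  move=> np nq; have h : block_form (0 : 'M[C]_4) (delta_mx p q).
    split=> [r nr||r nr]; rewrite !mxE ?[ord0 == p]eq_sym ?[ord0 == q]eq_sym;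
    by rewrite ?(negPf np) ?(negPf nq) ?andbF.
  have := ClD_block h; congr (ClD D _); apply: eq_Phi_in => c a b r.
  case: c => [|[|[|[|c]]]] //; rewrite /block_fun /= => /eqP -> _.
  by rewrite !mxE eq_sym (negPf np).
have Cl0 : ClD D 0 by rewrite -(scale0r (Munit R 0 ord0 ord0)); apply: gsa_scale.
case=> [|[|[|[|c]]]] p q.
- have [->|np] := eqVneq p ord0; last by rewrite Munit_out // => r; rewrite /= (negPf np).
  by have [->|nq] := eqVneq q ord0; last by rewrite Munit_out // => r _; rewrite /= (negPf nq).
- exact: U1.
- exact: U2.
- have [->|np] := eqVneq p ord0; first by rewrite Munit_out.
  have [->|nq] := eqVneq q ord0; first by rewrite Munit_out.
  exact: U3.
by rewrite Munit_out.
Qed.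

End Dirac.

End Clifford.

Theorem theorem17 (R : realType)
  (a13 a14 a23 a24 b13 b14 b23 b24 d12 d13 d14 d21 d22 d23 d24 ups : R[i]) :
  a13 = 0 -> a14 = 0 ->
  d12 = 0 -> d13 = 0 -> d14 = 0 -> d22 = 0 -> d23 = 0 -> d24 = 0 ->
  (Hodge (Dirac a13 a14 a23 a24 b13 b14 b23 b24
                d12 d13 d14 d21 d22 d23 d24 ups)
   <->
   [/\ d21 != 0, (a23, a24) != (0, 0), (b13, b14) != (0, 0)
     & (b23, b24) != (0, 0)]).
Proof.
move=> -> -> -> -> -> -> -> ->.
by split; [apply: Hodge_necessary | apply: Hodge_sufficient].
Qed.
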